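(* For every integer $d\ge 2$ there exist a constant $C>0$ (depending only on $d$) and, for every $\varepsilon\in(0,1)$, Borel probability measures $p_\varepsilon$ and $q_\varepsilon$ on $\mathbb{R}^d$ supported on $B_1$ such that $$W_1(p_\varepsilon,q_\varepsilon)\ \ge\ \frac{\varepsilon}{C}\qquad\text{and}\qquad SW_1(p_\varepsilon,q_\varepsilon)\ \le\ C\,\varepsilon^{d}.$$
   Context: $B_1$ denotes the closed Euclidean unit ball centered at $0$ in $\mathbb{R}^d$. For probability measures $\mu,\nu$ with finite first moment on a Euclidean space, $W_1(\mu,\nu)=\inf_{\gamma}\int |x-y|\,d\gamma(x,y)$ is the 1-Wasserstein distance, where the infimum runs over all probability measures $\gamma$ on the product space with marginals $\mu$ and $\nu$. For $\theta\in S^{d-1}$ (unit sphere of $\mathbb{R}^d$), let $P_\theta:\mathbb{R}^d\to\mathbb{R}$, $P_\theta(x)=\langle \theta,x\rangle$, and let $P_{\theta\#}\mu$ be the pushforward of $\mu$ by $P_\theta$. The sliced 1-Wasserstein distance is $$SW_1(\mu,\nu)=\int_{S^{d-1}} W_1(P_{\theta\#}\mu,P_{\theta\#}\nu)\,d\sigma_{d-1}(\theta),$$ where $\sigma_{d-1}$ is the uniform probability measure on $S^{d-1}$. *)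

(* Defs.v *)
From HB Require Import structures.
From mathcomp Require Import all_boot all_order all_algebra.
From mathcomp Require Import all_classical all_reals all_analysis.
From mathcomp Require Import measurable_realfun lra.
Set Implicit Arguments.
Unset Strict Implicit.
Unset Printing Implicit Defensive.
Import Order.TTheory GRing.Theory Num.Theory.
Import numFieldNormedType.Exports.
Local Open Scope classical_set_scope.
Local Open Scope ring_scope.

(* R^d is the type [d.-tuple R], with the product sigma-algebra of the
   library, i.e. the Borel sigma-algebra of R^d. *)

Section euclidean.
Context {R : realType} {d : nat}.
Implicit Types x y theta : d.-tuple R.

Definition inner theta x : R := \sum_(i < d) tnth theta i * tnth x i.

Definition enorm x : R := Num.sqrt (\sum_(i < d) tnth x i ^+ 2).

Definition edist x y : R :=
  Num.sqrt (\sum_(i < d) (tnth x i - tnth y i) ^+ 2).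

Definition unit_ball : set (d.-tuple R) := [set x | enorm x <= 1].

Definition unit_sphere : set (d.-tuple R) := [set x | enorm x = 1].

Definition normalize x : d.-tuple R := [tuple tnth x i / enorm x | i < d].

Lemma measurable_inner theta : measurable_fun setT (inner theta).
Proof.
rewrite /inner; apply: measurable_sum => i.
by apply: measurable_funM => //; exact: measurable_tnth.
Qed.

Lemma measurable_enorm : measurable_fun setT enorm.
Proof.
apply: (@measurableT_comp _ _ _ _ _ _ (@Num.sqrt R)).
  by apply: continuous_measurable_fun; exact: sqrt_continuous.
apply: measurable_sum => i.
by apply: measurable_funX; exact: measurable_tnth.
Qed.

Lemma measurable_unit_ball : measurable unit_ball.
Proof.
rewrite [X in measurable X](_ : _ = enorm @^-1` `]-oo, 1]).
  by rewrite -[X in measurable X]setTI; apply: measurable_enorm.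
by apply/seteqP; split=> x; rewrite /unit_ball /= in_itv.
Qed.

Lemma measurable_normalize : measurable_fun setT normalize.
Proof.
apply/measurable_fun_tnthP => i.
rewrite [X in measurable_fun _ X](_ : _ =
    (fun x => tnth x i) \* (@GRing.inv R \o enorm)); last first.
  by apply/funext => x /=; rewrite tnth_mktuple.
apply: measurable_funM; first exact: measurable_tnth.
rewrite [X in measurable_fun _ X](_ : _ = (@powR R ^~ (-1)) \o enorm).
  by apply: measurableT_comp; [exact: measurable_powR|exact: measurable_enorm].
by apply/funext => x /=; rewrite powR_inv1// sqrtr_ge0.
Qed.

HB.instance Definition _ theta :=
  isMeasurableFun.Build _ _ _ _ (inner theta) (measurable_inner theta).
HB.instance Definition _ :=
  isMeasurableFun.Build _ _ _ _ normalize measurable_normalize.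

End euclidean.

(* Lebesgue measure on R^n, as an iterated product.  The library puts
   [lebesgue_measure] on the alias [measurableTypeR R] of [R]. *)
Section lebesgue_tuple.
Context {R : realType}.
Local Open Scope ereal_scope.

Definition tcons n (p : n.-tuple R * measurableTypeR R) : n.+1.-tuple R :=
  [tuple of p.2 :: p.1].

Lemma measurable_tcons n : measurable_fun setT (@tcons n).
Proof. by apply: (@measurable_cons _ _ _ R snd n fst). Qed.

Definition lebesgue_step n (m : {measure set (n.-tuple R) -> \bar R}) :=
  pushforward (m \x @lebesgue_measure R) (@tcons n).

Section lebesgue_step_measure.
Variables (n : nat) (m : {measure set (n.-tuple R) -> \bar R}).

Let step0 : lebesgue_step m set0 = 0.
Proof. by rewrite /lebesgue_step /pushforward preimage_set0 measure0. Qed.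

Let step_ge0 A : 0 <= lebesgue_step m A.
Proof. by rewrite /lebesgue_step /pushforward measure_ge0. Qed.

Let step_sigma_additive : semi_sigma_additive (lebesgue_step m).
Proof. apply: measure_semi_sigma_additive; exact: measurable_tcons. Qed.

HB.instance Definition _ := isMeasure.Build _ _ _ (lebesgue_step m)
  step0 step_ge0 step_sigma_additive.

End lebesgue_step_measure.

Fixpoint lebesgue_tuple n : {measure set (n.-tuple R) -> \bar R} :=
  if n is n'.+1 then lebesgue_step (lebesgue_tuple n')
  else dirac [tuple].

Definition cube n (r : R) : set (n.-tuple R) :=
  [set x | forall i, tnth x i \in `[(- r)%R, r]].
Arguments cube : clear implicits.

Lemma measurable_cube n (r : R) : measurable (cube n r).
Proof.
rewrite (_ : cube n r =
    \big[setI/setT]_(i < n) ((fun x => tnth x i) @^-1` `[(- r)%R, r])).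
  apply: bigsetI_measurable => i _; rewrite -[X in measurable X]setTI.
  by apply: measurable_tnth.
apply/seteqP; split=> x; rewrite -bigcap_seq /cube/=.
  by move=> xr i _; exact: xr.
by move=> xr i; apply: xr => /=; rewrite mem_index_enum.
Qed.

Lemma lebesgue_tuple_cube n (r : R) : (0 <= r)%R ->
  lebesgue_tuple n (cube n r) = ((r *+ 2) ^+ n)%:E.
Proof.
move=> r0; elim: n => [|n IH] /=.
  by rewrite diracE mem_set // => -[].
rewrite /lebesgue_step /pushforward.
rewrite (_ : _ @^-1` _ = cube n r `*` `[(- r)%R, r]%classic); last first.
  apply/seteqP; split=> [[x y]|[x y] [/= xr yr] i] /=.
    move=> h; split; last exact: (h ord0).
    move=> i; have := h (lift ord0 i).
    by rewrite /tcons tnthS.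
  by have [j ->|->] := unliftP ord0 i; rewrite ?tnthS//; exact: xr.
rewrite product_measure1E //; last exact: measurable_cube.
rewrite IH.
suff lr : @lebesgue_measure R `[(- r)%R, r]%classic = (r *+ 2)%:E.
  by rewrite [X in _ * X]lr -EFinM -exprSr.
rewrite lebesgue_measure_itv/= lte_fin -EFinB opprK -mulr2n.
case: ifPn => // rr; have -> : r = 0%R; last by rewrite mul0rn.
by lra.
Qed.

Lemma unit_ball_cube n : @unit_ball R n `<=` cube n 1.
Proof.
move=> x xB i; rewrite in_itv/= -ler_norml (le_trans _ xB)// /enorm.
rewrite -sqrtr_sqr ler_sqrt; last by rewrite sumr_ge0// => j _; rewrite sqr_ge0.
by rewrite (bigD1 i)//= lerDl sumr_ge0// => j _; rewrite sqr_ge0.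
Qed.

Lemma cube_unit_ball n : cube n n.+1%:R^-1 `<=` @unit_ball R n.
Proof.
move=> x xc; rewrite /unit_ball/= /enorm -sqrtr1 ler_sqrt//.
apply: (@le_trans _ _ (\sum_(i < n) n.+1%:R^-1)%R).
  apply: ler_sum => i _; rewrite -real_normK ?num_real//.
  have := xc i; rewrite in_itv/= -ler_norml => xn.
  rewrite expr2 -[leRHS]mul1r ler_pM// (le_trans xn)//.
  by rewrite invf_le1// ler1n.
by rewrite sumr_const card_ord -[leLHS]mulr_natl ler_pdivrMr ?ltr0n// mul1r ler_nat.
Qed.

Lemma lebesgue_unit_ball_fin_num n :
  lebesgue_tuple n (@unit_ball R n) \is a fin_num.
Proof.
rewrite ge0_fin_numE//.
apply: (@le_lt_trans _ _ (lebesgue_tuple n (cube n 1))); last first.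
  by rewrite lebesgue_tuple_cube// ltry.
apply: (le_measure _ _ _ (@unit_ball_cube n)); rewrite inE.
  exact: measurable_unit_ball.
exact: measurable_cube.
Qed.

Lemma lebesgue_unit_ball_gt0 n : 0 < lebesgue_tuple n (@unit_ball R n).
Proof.
apply: (@lt_le_trans _ _ (lebesgue_tuple n (cube n n.+1%:R^-1))).
  by rewrite lebesgue_tuple_cube// lte_fin exprn_gt0// pmulrn_lgt0.
apply: (le_measure _ _ _ (@cube_unit_ball n)); rewrite inE.
  exact: measurable_cube.
exact: measurable_unit_ball.
Qed.

End lebesgue_tuple.
Arguments cube {R} n r.

Section sliced_wasserstein.
Context {R : realType}.
Local Open Scope ereal_scope.

Definition coupling {disp} {T : measurableType disp} (mu nu : probability T R) :
    set (probability (T * T)%type R) :=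
  [set gamma |
    (forall A, measurable A -> gamma (A `*` [set: T]) = mu A) /\
    (forall A, measurable A -> gamma ([set: T] `*` A) = nu A)].

Definition wasserstein1 {disp} {T : measurableType disp} (dist : T -> T -> R)
    (mu nu : probability T R) : \bar R :=
  ereal_inf [set \int[gamma]_z (dist z.1 z.2)%:E | gamma in coupling mu nu].

Definition W1 {d} (mu nu : probability (d.-tuple R) R) : \bar R :=
  wasserstein1 edist mu nu.

Definition W1_line (mu nu : probability R R) : \bar R :=
  wasserstein1 (fun x y : R => `|x - y|%R) mu nu.

(* Normalized restriction of Lebesgue measure to the unit ball.  The second
   argument of [mnormalize] is a default value used only when the total mass is
   0 or +oo, which is not the case here: see [uniform_ballE]. *)
Definition uniform_ball d : probability (d.-tuple R) R :=
  mnormalize (mrestr (lebesgue_tuple d) measurable_unit_ball)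
    (dirac ([tuple 0%R | i < d] : d.-tuple R)).

Lemma uniform_ballE d (A : set (d.-tuple R)) :
  uniform_ball d A = lebesgue_tuple d (A `&` unit_ball) *
                     (fine (lebesgue_tuple d (@unit_ball R d)))^-1%:E.
Proof.
have b0 := @lebesgue_unit_ball_gt0 R d.
have bfin := @lebesgue_unit_ball_fin_num R d.
have mT : mrestr (lebesgue_tuple d) measurable_unit_ball
    [set: d.-tuple R] = lebesgue_tuple d (@unit_ball R d).
  by rewrite /mrestr setTI.
rewrite /uniform_ball/= /mnormalize/= ![X in X == _]mT gt_eqF//=.
rewrite lt_eqF; last by rewrite [ltLHS]mT ltey_eq bfin.
by congr (_ * (fine _)^-1%:E).
Qed.

(* The uniform probability measure on the sphere is the image of the uniform one
   on the ball under the radial projection x |-> x / |x|. *)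
Definition uniform_sphere d : probability (d.-tuple R) R :=
  distribution (uniform_ball d) normalize.

Lemma uniform_sphereE d :
  (0 < d)%N -> uniform_sphere d (@unit_sphere R d) = 1%E.
Proof.
move=> d0; rewrite /uniform_sphere/= /distribution /pushforward/=.
have -> : normalize @^-1` (@unit_sphere R d) = ~` cube d (0 : R).
  apply/seteqP; split=> x /=; rewrite /unit_sphere/=.
    move=> nx1 x0; have e0 : enorm x = 0%R.
      rewrite /enorm big1 ?sqrtr0// => i _.
      have := x0 i; rewrite in_itv/= oppr0 -eq_le => /eqP <-.
      by rewrite expr0n.
    move: nx1; rewrite /enorm big1 ?sqrtr0; first by move/eqP; rewrite eq_sym oner_eq0.
    by move=> i _; rewrite tnth_mktuple e0 invr0 mulr0 expr0n.
  move=> x0; have xn0 : (0 < \sum_(i < d) tnth x i ^+ 2)%R.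
    rewrite lt0r sumr_ge0 ?andbT => [|i _]; last exact: sqr_ge0.
    apply/eqP => s0; apply: x0 => i.
    have /eqP := psumr_eq0P (fun j _ => sqr_ge0 (tnth x j)) s0 (i := i) isT.
    by rewrite sqrf_eq0 => /eqP ->; rewrite in_itv/= oppr0 lexx.
  have e2 : (enorm x ^+ 2 = \sum_(i < d) tnth x i ^+ 2)%R.
    by rewrite sqr_sqrtr// ltW.
  rewrite {1}/enorm (eq_bigr (fun i => tnth x i ^+ 2 / enorm x ^+ 2)%R).
    by rewrite -mulr_suml e2 divff ?sqrtr1// gt_eqF.
  by move=> i _; rewrite tnth_mktuple expr_div_n.
rewrite probability_setC; last exact: measurable_cube.
rewrite [X in 1 - X](_ : _ = 0) ?sube0// uniform_ballE.
rewrite [X in X * _](_ : _ = 0) ?mul0e//.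
apply/eqP; rewrite eq_le measure_ge0 andbT.
apply: (@le_trans _ _ (lebesgue_tuple d (cube d 0%R))).
  apply: le_measure; rewrite ?inE; last exact: subIsetl.
    by apply: measurableI; [exact: measurable_cube|exact: measurable_unit_ball].
  exact: measurable_cube.
by rewrite lebesgue_tuple_cube// mul0rn expr0n gtn_eqF.
Qed.

Definition SW1 {d} (mu nu : probability (d.-tuple R) R) : \bar R :=
  \int[uniform_sphere d]_(theta in unit_sphere)
    W1_line (distribution mu (inner theta)) (distribution nu (inner theta)).

End sliced_wasserstein.

(* Main.v *)
Require Import Defs.
From HB Require Import structures.
From mathcomp Require Import all_boot all_order all_algebra.
From mathcomp Require Import all_classical all_reals all_analysis.
From mathcomp Require Import measurable_realfun ring lra.
Import Order.TTheory GRing.Theory Num.Theory.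
Import numFieldNormedType.Exports.
Local Open Scope classical_set_scope.
Local Open Scope ring_scope.

(** Let [h] be a small multiple of [eps] and [c] a small constant.  The first
    coordinate of a point of [p] is an even multiple of [h], that of a point of
    [q] an odd multiple, so every coupling moves all the mass by at least [h]:
    [W1 p q >= h].

    The measures are made so that, for most directions [theta], the parity
    cannot be read off [<theta, x>].  Start from the points [0] and [h e_0] of
    parity even and odd.  A step along a coordinate [i <> 0] draws a fair bit
    [b] and an independent height [u], uniform in [0, 1], adds
    [b h e_0 + c u e_i] to the point and [b] to the parity.  Both measures are
    laws of points made by two steps along each [i <> 0], where the starting
    point is chosen so that the final parity is even for [p] and odd for [q].

    Put [a = theta_0 h] and [t = theta_i c].  A step adds [b a + t u] to
    [<theta, x>], and this number is unchanged when [b] is flipped and [u] is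
    moved by [a / t] in the right direction.  The move preserves the law of
    [(b, u)] and is possible unless [u] would leave [0, 1], an event of
    probability at most [loss a t = min 1 |a / t|].  Pair a point of [p] with the
    point of [q] obtained by flipping one bit that can be flipped: the two
    projections agree unless all the steps are stuck.  In that case only the
    starting point is exchanged, and the projections differ by [|a|].  Hence
    their laws are at distance at most
    [|a| * \prod_(i <> 0) loss (theta_0 h) (theta_i c) ^+ 2]
    ([W1_line_parity_law]), which is at most
    [h * \prod_(i <> 0) decay eps theta_i] with
    [decay eps x = 2 eps^2 / (eps^2 + x^2)].

    In the average over the sphere each of the [d - 1] factors contributes
    [O(eps)], because the integral of [decay eps] over the line is [2 pi eps],
    and [h] contributes one more [eps].  Two steps per coordinate are needed:
    with one, the factor [min 1 (eps / |x|)] would contribute an integral over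
    [[-1, 1]] of order [eps * ln (1 / eps)]. *)

Set Implicit Arguments.
Unset Strict Implicit.
Unset Printing Implicit Defensive.

(** * Measurability and integration *)

Definition mfun_of d d' (T : measurableType d) (T' : measurableType d')
  (f : T -> T') (mf : measurable_fun setT f) : {mfun T >-> T'} :=
  HB.pack f (isMeasurableFun.Build _ _ _ _ _ mf).

Lemma measurable_preimage d d' (T : measurableType d) (T' : measurableType d')
    (f : T -> T') (A : set T') :
  measurable_fun setT f -> measurable A -> measurable (f @^-1` A).
Proof. by move=> mf mA; rewrite -[X in measurable X]setTI; exact: mf. Qed.

Lemma measurable_boolset d (T : measurableType d) (f : T -> bool) :
  measurable_fun setT f -> measurable [set x | f x].
Proof. by move=> mf; exact: (measurable_preimage (A := [set true]) mf). Qed.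

Lemma measurable_fun_eqb d (T : measurableType d) (f g : T -> bool) :
  measurable_fun setT f -> measurable_fun setT g ->
  measurable_fun setT (fun v => f v == g v).
Proof.
move=> mf mg; rewrite (_ : (fun v => _) =
  (fun v => if f v then g v else ~~ g v)).
  by apply: measurable_fun_ifT => //; exact: measurable_neg.
by apply/funext => v; case: (f v); case: (g v).
Qed.

(** The integral of a nonnegative function is a supremum over the simple functions
    below it, so it is monotone without measurability.  This is what bounds
    [SW1], whose integrand is an infimum over couplings. *)
Lemma ge0_le_integral_nonmeasurable d (T : measurableType d) (R : realType)
    (mu : {measure set T -> \bar R}) (D : set T) (f g : T -> \bar R) :
  (forall x, D x -> 0 <= f x)%E -> (forall x, D x -> f x <= g x)%E ->
  (\int[mu]_(x in D) f x <= \int[mu]_(x in D) g x)%E.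
Proof.
move=> f0 fg; rewrite !ge0_integralE//; last first.
  by move=> x Dx; exact: (le_trans (f0 x Dx) (fg x Dx)).
apply: ereal_sup_le => _ /= [k kf <-]; exists k => // x.
apply: (le_trans (kf x)); rewrite /patch; case: ifPn => //.
by rewrite inE => /fg.
Qed.

(** * One step: a bit and a height coded by a real number *)

Section step.
Context {R : realType}.
Implicit Types (rho : R) (A : set R).

Lemma measurable_reflect rho :
  measurable_fun setT (fun v : measurableTypeR R => rho - v : measurableTypeR R).
Proof. exact: measurable_funB. Qed.

Lemma lebesgue_measure_reflect rho A : measurable A ->
  lebesgue_measure ((fun v => rho - v) @^-1` A) = lebesgue_measure A :> \bar R.
Proof.
move=> mA; pose f := mfun_of (measurable_reflect rho).
rewrite (_ : lebesgue_measure (_ @^-1` A) =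
  pushforward (@lebesgue_measure R) f A)//.
apply/esym; apply: (@lebesgue_measure_unique R
  [the measure _ _ of pushforward (@lebesgue_measure R) f]) => // _ [[a b] _ <-].
rewrite [RHS](_ : _ = lebesgue_measure `[rho - b, rho - a[%classic).
  rewrite !lebesgue_measure_itv/= !lte_fin ltrD2l ltrN2.
  by case: ifP => // _; rewrite -!EFinD; congr EFin; lra.
congr (lebesgue_measure _).
apply/seteqP; split => v /=; rewrite !in_itv/=; lra.
Qed.

Lemma ltrN11 : -1 < 1 :> R. Proof. lra. Qed.

(** A fair bit and a uniform height are read off one uniform variable of
    [[-1, 1]], as its sign and its absolute value ([bit] and [height] below).
    With this coding, flipping the bit while moving the height by [rho] is the
    reflection [v |-> rho - v]. *)
Definition unif : probability (measurableTypeR R) R := uniform_prob ltrN11.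

Lemma unifE A : measurable A ->
  unif A = (2^-1%:E * lebesgue_measure (A `&` `[-1, 1])%R)%E.
Proof.
move=> mA; rewrite /unif /= /uniform_prob integral_uniform_pdf.
rewrite (eq_integral (fun=> 2^-1%:E)); last first.
  move=> x; rewrite inE/= in_itv/= /uniform_pdf => -[_ ->].
  by congr (_^-1%:E); lra.
by rewrite integral_cst//; exact: measurableI.
Qed.

(** The event that the reflection keeps the variable in [[-1, 1]] and changes its
    sign.  It is invariant under the reflection, so that reflecting on it and
    doing nothing elsewhere preserves [unif]. *)
Definition crosses rho (v : R) : bool :=
  [&& `|v| <= 1, `|rho - v| <= 1 & (v < 0) != (rho - v < 0)].

Lemma crosses_reflect rho v : crosses rho (rho - v) = crosses rho v.
Proof. by rewrite /crosses subKr andbCA eq_sym. Qed.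

(** The guard [t != 0] matters: [a / 0 = 0] would give the reflection [v |-> - v],
    which does not preserve the increment of the projection. *)
Definition flip (a t v : R) : R :=
  if (t != 0) && crosses (a / t) v then a / t - v else v.

Lemma measurable_normr_le1 (f : measurableTypeR R -> measurableTypeR R) :
  measurable_fun setT f -> measurable_fun setT (fun v => `|f v| <= 1).
Proof.
by move=> mf; apply: measurable_fun_ler => //; exact: measurableT_comp.
Qed.

Lemma measurable_fun_lt0 (f : measurableTypeR R -> measurableTypeR R) :
  measurable_fun setT f -> measurable_fun setT (fun v => f v < 0).
Proof. by move=> mf; exact: measurable_fun_ltr. Qed.

Lemma measurable_crosses rho :
  measurable_fun setT (crosses rho : measurableTypeR R -> bool).
Proof.
have mr := measurable_reflect rho.
apply: measurable_and; first exact: measurable_normr_le1.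
apply: measurable_and; first exact: measurable_normr_le1.
apply: measurable_neg; apply: measurable_fun_eqb; exact: measurable_fun_lt0.
Qed.

Lemma measurable_flip a t :
  measurable_fun setT (flip a t : measurableTypeR R -> measurableTypeR R).
Proof.
apply: measurable_fun_ifT => //; last exact: measurable_reflect.
by apply: measurable_and => //; exact: measurable_crosses.
Qed.

(** On the set where it moves, [flip a t] is a reflection leaving that set
    invariant, and reflections preserve Lebesgue measure. *)
Lemma unif_flip a t A : measurable A -> unif (flip a t @^-1` A) = unif A.
Proof.
move=> mA.
have mf : measurable (flip a t @^-1` A).
  exact: measurable_preimage (@measurable_flip a t) mA.
rewrite !unifE//; congr (_ * _)%E.
pose rho := a / t.
pose I : set (measurableTypeR R) := [set v | (t != 0) && crosses rho v].
have mI : measurable I.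
  apply: measurable_boolset; apply: measurable_and => //.
  exact: measurable_crosses.
have IB : I `<=` `[-1, 1].
  by move=> v /andP[_ /and3P[+ _ _]]; rewrite ler_norml/= in_itv.
have split (B : set (measurableTypeR R)) : measurable B ->
    lebesgue_measure (B `&` `[-1, 1]) =
    (lebesgue_measure (B `&` I) + lebesgue_measure (B `&` (`[-1, 1] `\` I))%R)%E.
  move=> mB; rewrite -measureU//; first last.
  - by apply/seteqP; split => // v /= [[_ Iv] [_ []]].
  - by apply: measurableI => //; exact: measurableD.
  - exact: measurableI.
  by rewrite -setIUr setDUK.
rewrite !split//; congr (_ + _)%E.
  rewrite -[RHS](lebesgue_measure_reflect rho)//; last exact: measurableI.
  congr (lebesgue_measure _); apply/seteqP; split => v /=; rewrite /flip /I/=.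
    by move=> [+ Iv]; rewrite Iv crosses_reflect.
  by rewrite crosses_reflect => -[+ Iv]; rewrite Iv.
congr (lebesgue_measure _); apply/seteqP; split => v /= [Av [v1 Iv]];
  by move: Av; rewrite /flip; move: Iv; rewrite /I /= => /negP/negbTE ->.
Qed.

Definition bit (v : R) : bool := v < 0.

(** The truncation at 1 changes nothing for [unif]; it makes the bounds on the
    support hold everywhere and not only almost everywhere. *)
Definition height (v : R) : R := Num.min `|v| 1.

Definition stuck a t v : bool := bit (flip a t v) == bit v.

Lemma measurable_bit : measurable_fun setT (bit : measurableTypeR R -> bool).
Proof. exact: measurable_fun_lt0. Qed.

Lemma measurable_height :
  measurable_fun setT (height : measurableTypeR R -> R).
Proof. by apply: measurable_minr => //; exact: measurableT_comp. Qed.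

Lemma measurable_stuck a t :
  measurable_fun setT (stuck a t : measurableTypeR R -> bool).
Proof.
apply: measurable_fun_eqb; last exact: measurable_bit.
by apply: measurable_fun_lt0; exact: measurable_flip.
Qed.

Lemma flip_stuck a t v : stuck a t v -> flip a t v = v.
Proof.
rewrite /stuck /flip /bit; case: ifP => // /andP[_ /and3P[_ _]].
by rewrite eq_sym => /negbTE ->.
Qed.

(** The increment [b a + t u] of the projection is blind to the flip: the bit
    gains or loses [a], and [t * u] loses or gains [t * (a / t)]. *)
Lemma flip_unstuck a t v : ~~ stuck a t v ->
  bit (flip a t v) = ~~ bit v /\
  (bit (flip a t v))%:R * a + t * height (flip a t v) =
  (bit v)%:R * a + t * height v.
Proof.
rewrite /stuck /flip; case: ifP => [|_]; last by rewrite eqxx.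
move=> /andP[t0 /and3P[v1 w1 _]]; rewrite /height /bit !min_l// => ne.
split; first by move: ne; case: (_ < _); case: (_ < _).
have ta : t * (a / t) = a by rewrite mulrC divfK.
move: ne; case: ltP => w0; case: ltP => v0 // _;
  rewrite ?(ltr0_norm w0) ?(ger0_norm w0) ?(ltr0_norm v0) ?(ger0_norm v0)
    ?opprB mulrBr ta /= ?mul0r ?mul1r ?mulrN; lra.
Qed.

Definition loss (a t : R) : R := if t == 0 then 1 else Num.min 1 `|a / t|.

(** Up to null sets, the stuck [v] form two intervals of length [|rho|], with
    [rho = a / t]: those between [0] and [rho], which keep their sign, and those
    which would leave [[-1, 1]]. *)
Lemma unif_stuck a t : (unif [set v | stuck a t v]%R <= (loss a t)%:E)%E.
Proof.
set B : set (measurableTypeR R) := [set _ | _].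
have mB : measurable B by exact: measurable_boolset (@measurable_stuck a t).
have B1 : (unif B <= 1)%E by exact: probability_le1.
rewrite /loss; case: eqP => [//|/eqP t0].
rewrite EFin_min le_min B1/= unifE//.
set rho := a / t.
pose U : set (measurableTypeR R) := `[-1, 1]%classic.
have itvS (x y x' y' : R) : x <= y -> x' <= y' ->
    B `&` U `<=` `[x, y] `|` `[x', y'] -> (y - x) + (y' - x') <= 2 * `|rho| ->
    (2^-1%:E * lebesgue_measure (B `&` U) <= `|rho|%:E)%E.
  move=> xy xy' sub le.
  rewrite -lee_pdivlMl ?invr_gt0// invrK.
  apply: (@le_trans _ _ ((y - x) + (y' - x'))%:E); last by rewrite lee_fin.
  apply: (le_trans (le_measure _ _ _ sub)).
  - by rewrite inE; apply: measurableI => //; exact: measurable_itv.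
  - by rewrite inE; apply: measurableU; exact: measurable_itv.
  apply: le_trans; first by apply: measureU2; exact: measurable_itv.
  have len (l r : R) : l <= r ->
      lebesgue_measure (`[l, r]%classic : set (measurableTypeR R)) = (r - l)%:E.
    move=> lr; rewrite lebesgue_measure_itv/= lte_fin -EFinD.
    by case: ifPn => // ?; congr EFin; lra.
  by rewrite EFinD -!len.
have B_cases v : B v -> U v ->
    [\/ v < 0 /\ rho - v < 0, 0 <= v /\ 0 <= rho - v, rho - v < -1 | 1 < rho - v].
  rewrite /U/= in_itv/= -ler_norml /B/= => + v1.
  rewrite /stuck /flip /bit /crosses t0 v1 /= -/rho.
  case: ifPn => [/andP[_ /negbTE]|]; first by rewrite eq_sym => ->.
  rewrite negb_and negbK ler_norml negb_and -!ltNge => /orP[/orP[]? _|+ _].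
  - exact: Or43.
  - exact: Or44.
  by case: ltP; case: ltP => //; do ?[by constructor].
have [rho0|rho0] := leP 0 rho.
  apply: (itvS (-1) (-1 + rho) 0 rho); [lra|lra| |rewrite ger0_norm//; lra].
  move=> v [Bv Uv]; have := B_cases v Bv Uv.
  move: Uv; rewrite /U/= !in_itv/= => /andP[? ?] [[]|[]||] => *;
    [lra|right; lra|lra|left; lra].
apply: (itvS (1 + rho) 1 rho 0); [lra|lra| |rewrite ltr0_norm//; lra].
move=> v [Bv Uv]; have := B_cases v Bv Uv.
by move: Uv; rewrite /U/= !in_itv/= => /andP[? ?] [[]|[]||] => *;
  [right; lra|lra|left; lra|lra].
Qed.

End step.

(** * Parity pairs *)

Section skew_product.
Context {R : realType} {d1 d2 : measure_display}.
Context {T1 : measurableType d1} {T2 : measurableType d2}.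
Variables (phi : T1 -> T1) (beta : T1 -> bool) (psi : T2 -> T2).

Definition skew (z : T1 * T2) : T1 * T2 :=
  (phi z.1, if beta z.1 then psi z.2 else z.2).

Hypotheses (mphi : measurable_fun setT phi) (mbeta : measurable_fun setT beta)
  (mpsi : measurable_fun setT psi).

Lemma measurable_skew : measurable_fun setT skew.
Proof.
apply: measurable_fun_pair; first exact: measurableT_comp.
apply: measurable_fun_ifT => //; exact: measurableT_comp.
Qed.

(** On a rectangle the preimage splits according to [beta] into two rectangles;
    each has the mass that [psi = id] would give it. *)
Lemma skew_preserving (P1 : probability T1 R) (P2 : probability T2 R) :
  (forall A, measurable A -> P1 (phi @^-1` A) = P1 A) ->
  (forall A, measurable A -> P2 (psi @^-1` A) = P2 A) ->
  forall A, measurable A -> (P1 \x P2)%E (skew @^-1` A) = (P1 \x P2)%E A.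
Proof.
move=> phiP psiP A mA.
pose f := mfun_of measurable_skew.
apply/esym.
apply: (@product_measure_unique _ _ _ _ _ P1 P2
  [the measure _ _ of pushforward (P1 \x P2)%E f]) => // X Y mX mY.
pose B := beta @^-1` [set true].
have mB : measurable B by exact: measurable_preimage.
have mXp := measurable_preimage mphi mX.
have mYp := measurable_preimage mpsi mY.
rewrite [LHS](_ : _ = (P1 \x P2)%E
    (((phi @^-1` X `&` B) `*` (psi @^-1` Y)) `|` ((phi @^-1` X `\` B) `*` Y))); last first.
  congr ((P1 \x P2)%E _); apply/seteqP; split => -[v w]; rewrite /B /=.
    by case: (beta v) => -[Xv Yw]; [left|right].
  by case: (beta v) => -[] [[]].
rewrite measureU; first last.
- by apply/seteqP; split => // -[v w] /= [[[_ +] _] [[_ +] _]].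
- by apply: measurableX => //; exact: measurableD.
- by apply: measurableX => //; exact: measurableI.
have mB1 : measurable (phi @^-1` X `&` B) by exact: measurableI.
have mB2 : measurable (phi @^-1` X `\` B) by exact: measurableD.
rewrite [X in (X + _)%E](product_measure1E P1 P2 mB1 mYp).
rewrite [X in (_ + X)%E](product_measure1E P1 P2 mB2 mY).
rewrite [X in (_ * X + _)%E](psiP _ mY) -ge0_muleDl// -measureU//; last first.
  by apply/seteqP; split => // v /= [[_ +] [_ +]].
by rewrite setUIDK; congr (_ * _)%E; exact: phiP.
Qed.

End skew_product.

Section parity_pair.
Context {R : realType} {n : nat} (h c : R).
Hypotheses (h0 : 0 <= h) (c0 : 0 <= c).
Implicit Types (theta x : n.+1.-tuple R) (s : seq 'I_n.+1).

(** [X e] is a random point of parity [e] made by one step along each coordinate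
    of the list [s].  In [parity_pair_switch], [phi] is the change of randomness
    that flips the first bit which is not stuck, and [stay] is the event that
    all of them are stuck; off [stay], [X e] and [X (~~ e) \o phi] have the same
    projection along [theta]. *)
Record parity_pair s disp (T : measurableType disp) (P : probability T R)
    (X : bool -> T -> n.+1.-tuple R) : Prop := ParityPair {
  parity_pair_measurable : forall e, measurable_fun setT (X e);
  parity_pair_lattice : forall e w,
    exists k : nat, odd k = e /\ tnth (X e w) ord0 = k%:R * h;
  parity_pair_bounded : forall e w,
    \sum_j `|tnth (X e w) j| <= h * (size s).+1%:R + c * (size s)%:R;
  parity_pair_switch : forall theta, exists (phi : T -> T) (stay : T -> bool),
    [/\ measurable_fun setT phi, measurable_fun setT stay,
        forall A, measurable A -> P (phi @^-1` A) = P A,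
        (P [set w | stay w]
           <= (\prod_(i <- s) loss (tnth theta ord0 * h) (tnth theta i * c))%:E)%E &
        forall e w, `|inner theta (X e w) - inner theta (X (~~ e) (phi w))|
          = (stay w)%:R * `|tnth theta ord0 * h| ] }.

Definition axis (i : 'I_n.+1) (r : R) : n.+1.-tuple R :=
  [tuple (j == i)%:R * r | j < n.+1].

Definition addt x y : n.+1.-tuple R := [tuple tnth x j + tnth y j | j < n.+1].

Lemma inner_addt theta x y : inner theta (addt x y) = inner theta x + inner theta y.
Proof.
rewrite /inner -big_split; apply: eq_bigr => j _.
by rewrite tnth_mktuple mulrDr.
Qed.

Lemma inner_axis theta i r : inner theta (axis i r) = tnth theta i * r.
Proof.
rewrite /inner (bigD1 i)//= tnth_mktuple eqxx mul1r big1 ?addr0// => j /negbTE ji.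
by rewrite tnth_mktuple ji mul0r mulr0.
Qed.

Lemma l1_addt x y :
  \sum_j `|tnth (addt x y) j| <= \sum_j `|tnth x j| + \sum_j `|tnth y j|.
Proof.
by rewrite -big_split; apply: ler_sum => j _; rewrite tnth_mktuple ler_normD.
Qed.

Lemma l1_axis i r : \sum_j `|tnth (axis i r) j| = `|r|.
Proof.
rewrite (bigD1 i)//= tnth_mktuple eqxx mul1r big1 ?addr0// => j /negbTE ji.
by rewrite tnth_mktuple ji mul0r normr0.
Qed.

Lemma measurable_axis i : measurable_fun setT (axis i).
Proof.
apply/measurable_fun_tnthP => j; rewrite (_ : _ \o _ =
  fun r => (j == i)%:R * r).
  exact: measurable_funM.
by apply/funext => r /=; rewrite tnth_mktuple.
Qed.

Lemma measurable_addt d (T : measurableType d) (f g : T -> n.+1.-tuple R) :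
  measurable_fun setT f -> measurable_fun setT g ->
  measurable_fun setT (fun w => addt (f w) (g w)).
Proof.
move=> /measurable_fun_tnthP mf /measurable_fun_tnthP mg.
apply/measurable_fun_tnthP => j.
rewrite (_ : _ \o _ = fun w => tnth (f w) j + tnth (g w) j).
  by apply: measurable_funD; [exact: mf|exact: mg].
by apply/funext => r /=; rewrite tnth_mktuple.
Qed.

Lemma parity_pair_nil disp (T : measurableType disp) (P : probability T R) :
  parity_pair [::] P (fun e _ => axis ord0 (e%:R * h)).
Proof.
split => //.
- move=> e w; exists e; split; first by case: e.
  by rewrite tnth_mktuple eqxx mul1r.
- move=> e w; rewrite l1_axis mulr1 mulr0 addr0.
  by case: e; rewrite /= ?mul1r ?mul0r ?normr0 ?ger0_norm.
- move=> theta; exists id, xpredT; split => //.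
    rewrite big_nil (_ : [set _ | _] = setT) ?probability_setT//.
    by apply/seteqP; split.
  move=> e w; rewrite !inner_axis mul1r -mulrBr -mulrBl !normrM.
  by case: e => /=; rewrite ?subr0 ?sub0r ?normrN ?normr1 ?mul1r.
Qed.

(** The new step is tried first: if its bit can be flipped the earlier randomness
    is left alone, and otherwise the earlier steps are asked to flip the parity.
    The product law makes the two failures independent.  A step along the
    coordinate 0 itself would spoil the lattice structure. *)
Lemma parity_pair_cons s i disp (T : measurableType disp) (P : probability T R) X :
  i != ord0 -> parity_pair s P X ->
  parity_pair (i :: s) (@unif R \x P)%E (fun e z =>
    addt (X (e (+) bit z.1) z.2)
      (addt (axis ord0 ((bit z.1)%:R * h)) (axis i (c * height z.1)))).
Proof.
move=> i0 [mX latX bX swX]; split.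
- move=> e; apply: measurable_addt; last apply: measurable_addt.
  + rewrite (_ : (fun z => _) = fun z : measurableTypeR R * T =>
        if bit z.1 then X (~~ e) z.2 else X e z.2).
      apply: measurable_fun_ifT.
      - by apply: measurableT_comp => //; exact: measurable_bit.
      - exact: measurableT_comp.
      - exact: measurableT_comp.
    by apply/funext => z; case: (bit _); rewrite ?addbT ?addbF.
  + apply: measurableT_comp; first exact: measurable_axis.
    apply: measurable_funM => //.
    rewrite (_ : (fun z => _) =
        fun z : measurableTypeR R * T => if bit z.1 then 1 else 0).
      apply: measurable_fun_ifT => //.
      by apply: measurableT_comp => //; exact: measurable_bit.
    by apply/funext => z; case: (bit _).
  + apply: measurableT_comp; first exact: measurable_axis.
    apply: measurable_funM => //.
    by apply: measurableT_comp => //; exact: measurable_height.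
- move=> e [v w] /=; have [k [ke Xk]] := latX (e (+) bit v) w.
  exists (k + bit v)%N; split; first by rewrite oddD ke oddb addbK.
  rewrite !tnth_mktuple Xk eqxx mul1r eq_sym (negbTE i0) mul0r addr0.
  by rewrite -mulrDl natrD.
- move=> e [v w] /=; apply: (le_trans (l1_addt _ _)).
  rewrite [size _]/= (_ : _ + _ =
    (h * (size s).+1%:R + c * (size s)%:R) + (h + c)).
    2: by rewrite !mulrS; ring.
  apply: lerD; first exact: bX.
  apply: (le_trans (l1_addt _ _)); rewrite !l1_axis; apply: lerD.
    by case: (bit v); rewrite /= ?mul1r ?mul0r ?normr0// ger0_norm.
  have hv : 0 <= height v by rewrite /height le_min normr_ge0 ler01.
  by rewrite ger0_norm ?mulr_ge0// ler_piMr// /height ge_min lexx orbT.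
- move=> theta; have [phi [stay [mphi mstay phiP stayP XE]]] := swX theta.
  set a := tnth theta ord0 * h; set t := tnth theta i * c.
  have mst := @measurable_stuck R a t.
  exists (skew (flip a t) (stuck a t) phi),
    (fun z => stuck a t z.1 && stay z.2); split.
  + by apply: measurable_skew => //; exact: measurable_flip.
  + by apply: measurable_and; exact: measurableT_comp.
  + apply: skew_preserving => //; first exact: measurable_flip.
    exact: unif_flip.
  + rewrite [X in (_ X <= _)%E](_ : _ =
      [set v | stuck a t v]%R `*` [set w | stay w]); last first.
      by apply/seteqP; split => -[v w] /=; rewrite -(rwP andP).
    have mS := measurable_boolset mst.
    have mW := measurable_boolset mstay.
    rewrite [X in (X <= _)%E](product_measure1E (@unif R) P mS mW).
    by rewrite big_cons EFinM; apply: lee_pmul => //; exact: unif_stuck.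
  + move=> e [v w]; rewrite /skew/= !inner_addt !inner_axis.
    have [stv|ustv] := boolP (stuck a t v).
      rewrite (eqP stv) flip_stuck// addNb -(XE (e (+) bit v) w).
      by congr `|_|; ring.
    have [-> E] := flip_unstuck ustv.
    rewrite mul0r [X in `|X|](_ : _ = 0) ?normr0//.
    rewrite addNb addbN negbK opprD addrACA subrr add0r.
    move: E; rewrite /a /t => E; nra.
Qed.

End parity_pair.

(** * Wasserstein distances of a parity pair *)

Section wasserstein_bounds.
Context {R : realType} {n : nat} (h c : R).
Hypotheses (h0 : 0 <= h) (c0 : 0 <= c).
Implicit Types (theta x y : n.+1.-tuple R) (s : seq 'I_n.+1).

Lemma exists_parity_pair s : ord0 \notin s ->
  exists disp (T : measurableType disp) (P : probability T R) X,
    @parity_pair R n h c s disp T P X.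
Proof.
elim: s => [_|i s IH].
  by exists _, _, (@unif R); eexists; exact: parity_pair_nil.
rewrite inE negb_or => /andP[i0 /IH[disp [T [P [X sX]]]]].
exists _, _, (@unif R \x P)%E; eexists.
by apply: (parity_pair_cons h0 c0 _ sX); rewrite eq_sym.
Qed.

Lemma measurable_edist :
  measurable_fun setT
    (fun z : n.+1.-tuple R * n.+1.-tuple R => Defs.edist z.1 z.2).
Proof.
apply: (@measurableT_comp _ _ _ _ _ _ (@Num.sqrt R)).
  by apply: continuous_measurable_fun; exact: sqrt_continuous.
apply: measurable_sum => i; apply: measurable_funX; apply: measurable_funB.
  exact: (measurableT_comp (measurable_tnth i) measurable_fst).
exact: (measurableT_comp (measurable_tnth i) measurable_snd).
Qed.

Lemma tnth_enorm x i : `|tnth x i| <= enorm x.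
Proof.
rewrite -sqrtr_sqr /enorm ler_sqrt; last first.
  by apply: sumr_ge0 => j _; exact: sqr_ge0.
by rewrite (bigD1 i)//= lerDl sumr_ge0// => j _; exact: sqr_ge0.
Qed.

Lemma tnth_edist x y i : `|tnth x i - tnth y i| <= Defs.edist x y.
Proof.
rewrite -sqrtr_sqr /Defs.edist ler_sqrt; last first.
  by apply: sumr_ge0 => j _; exact: sqr_ge0.
by rewrite (bigD1 i)//= lerDl sumr_ge0// => j _; exact: sqr_ge0.
Qed.

Lemma enorm_l1 x : enorm x <= \sum_j `|tnth x j|.
Proof.
have S0 : 0 <= \sum_j `|tnth x j| by apply: sumr_ge0.
rewrite -[leRHS]ger0_norm// -sqrtr_sqr /enorm ler_sqrt ?sqr_ge0//.
rewrite expr2 mulr_suml; apply: ler_sum => i _.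
rewrite -real_normK ?num_real// expr2 ler_wpM2l//.
by rewrite (bigD1 i)//= lerDl sumr_ge0.
Qed.

Variables (s : seq 'I_n.+1) (disp : measure_display) (T : measurableType disp).
Variables (P : probability T R) (X : bool -> T -> n.+1.-tuple R).
Hypothesis sX : parity_pair h c s P X.

Definition parity_law e : probability (n.+1.-tuple R) R :=
  distribution P (mfun_of (parity_pair_measurable sX e)).

Lemma parity_law_unit_ball e :
  h * (size s).+1%:R + c * (size s)%:R <= 1 -> parity_law e unit_ball = 1%E.
Proof.
move=> le1; rewrite /parity_law /= /distribution /pushforward.
rewrite (_ : _ @^-1` _ = setT) ?probability_setT//.
apply/seteqP; split => // w _.
apply: le_trans (le_trans (parity_pair_bounded sX e w) le1); exact: enorm_l1.
Qed.

Definition lattice e : set (n.+1.-tuple R) :=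
  (fun x => tnth x ord0) @^-1` [set k%:R * h | k in [set k | odd k = e]].

Lemma measurable_lattice e : measurable (lattice e).
Proof.
apply: measurable_preimage; first exact: measurable_tnth.
apply: countable_measurable; first by move=> r; exact: measurable_set1.
by apply: (sub_countable (card_image_le _ _)); exact: countableP.
Qed.

Lemma parity_law_lattice e : parity_law e (lattice e) = 1%E.
Proof.
rewrite /parity_law /= /distribution /pushforward.
rewrite (_ : _ @^-1` _ = setT) ?probability_setT//.
apply/seteqP; split => // w _.
by have [k [ke kX]] := parity_pair_lattice sX e w; exists k.
Qed.

Lemma lattice_edist x y : lattice false x -> lattice true y -> h <= Defs.edist x y.
Proof.
move=> [k /= ke kx] [l /= le ly]; apply: (le_trans _ (tnth_edist x y ord0)).
rewrite -kx -ly -mulrBl normrM (ger0_norm h0) ler_peMl//.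
have [kl|lk|kl] := ltngtP k l.
- by rewrite distrC -natrB ?(ltnW kl)// ger0_norm// ler1n subn_gt0.
- by rewrite -natrB ?(ltnW lk)// ger0_norm// ler1n subn_gt0.
- by move: ke; rewrite kl le.
Qed.

(** Every coupling is carried by the product of the even and odd lattices. *)
Lemma W1_parity_law : (h%:E <= W1 (parity_law false) (parity_law true))%E.
Proof.
apply/ereal_infP => _ [g [gp gq] <-].
pose E := (lattice false `*` setT) `&` (setT `*` lattice true).
have mE0 : measurable (lattice false `*` @setT (n.+1.-tuple R)).
  by apply: measurableX => //; exact: measurable_lattice.
have mE1 : measurable (@setT (n.+1.-tuple R) `*` lattice true).
  by apply: measurableX => //; exact: measurable_lattice.
have mE : measurable E by exact: measurableI.
have nE : g (~` E) = 0%E.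
  apply/eqP; rewrite eq_le measure_ge0 andbT setCI.
  apply: le_trans; first by apply: measureU2; exact: measurableC.
  rewrite [X in (X + _ <= _)%E](_ : _ = 0%E); last first.
    rewrite [LHS]probability_setC// gp ?parity_law_lattice ?subee//.
    exact: measurable_lattice.
  rewrite [X in (_ + X <= _)%E](_ : _ = 0%E) ?adde0//.
  rewrite [LHS]probability_setC// gq ?parity_law_lattice ?subee//.
  exact: measurable_lattice.
have gE : g E = 1%E.
  have := probability_setC g (measurableC mE).
  by rewrite setCK nE sube0.
have me : measurable_fun setT
    (fun z : n.+1.-tuple R * n.+1.-tuple R => (Defs.edist z.1 z.2)%:E).
  by apply/measurable_EFinP; exact: measurable_edist.
apply: (@le_trans _ _ (\int[g]_(z in E) (Defs.edist z.1 z.2)%:E)%E); last first.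
  apply: ge0_subset_integral => //.
  by move=> z _; rewrite lee_fin sqrtr_ge0.
apply: (@le_trans _ _ (\int[g]_(z in E) (cst h%:E z))%E).
  by rewrite integral_cst// [X in (_ <= _ * X)%E]gE mule1.
apply: ge0_le_integral => //.
- exact: measurable_funTS.
- by move=> z [[z1 _] [_ z2]]; rewrite lee_fin; exact: lattice_edist.
Qed.

(** The coupling is the joint law of the projections of [X false] and
    [X true \o phi]; its second marginal is right because [phi] preserves [P]. *)
Lemma W1_line_parity_law theta :
  (W1_line (distribution (parity_law false) (inner theta))
           (distribution (parity_law true) (inner theta))
   <= (`|tnth theta ord0 * h| *
       \prod_(i <- s) loss (tnth theta ord0 * h) (tnth theta i * c))%:E)%E.
Proof.
have [phi [stay [mphi mstay phiP stayP XE]]] := parity_pair_switch sX theta.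
pose f w := (inner theta (X false w), inner theta (X true (phi w))).
have m0 : measurable_fun setT (fun w => inner theta (X false w)).
  apply: measurableT_comp; first exact: measurable_inner.
  exact: (parity_pair_measurable sX).
have m1 : measurable_fun setT (fun w => inner theta (X true w)).
  apply: measurableT_comp; first exact: measurable_inner.
  exact: (parity_pair_measurable sX).
have mf : measurable_fun setT f.
  by apply: measurable_fun_pair => //; exact: measurableT_comp m1 mphi.
pose g : probability (R * R)%type R := distribution P (mfun_of mf).
have gE : coupling (distribution (parity_law false) (inner theta))
    (distribution (parity_law true) (inner theta)) g.
  split => A mA.
    by congr (P _); apply/seteqP; split => w; [case|split].
  rewrite -[RHS]phiP.
    by congr (P _); apply/seteqP; split => w; [case|split].
  exact: measurable_preimage m1 mA.
have mstayS := measurable_boolset mstay.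
apply: (@le_trans _ _ (\int[g]_z (`|z.1 - z.2|)%:E)%E).
  by apply: ereal_inf_lbound; exists g.
have mdist : measurable_fun setT (fun z : R * R => (`|z.1 - z.2|)%:E).
  apply/measurable_EFinP; apply: measurableT_comp => //.
  exact: measurable_funB.
rewrite ge0_integral_distribution//.
rewrite (_ : _ \o _ = fun w =>
    (`|tnth theta ord0 * h|%:E * (\1_[set w | stay w] w)%:E)%E); last first.
  apply/funext => w /=; rewrite -EFinM; congr EFin.
  rewrite (XE false w) mulrC indicE; congr (_ * (nat_of_bool _)%:R).
  by apply/idP/idP => [sw|]; [rewrite mem_set|rewrite inE].
rewrite ge0_integralZl//.
  rewrite integral_indic// setIT EFinM.
  by apply: lee_wpmul2l => //; rewrite lee_fin.
by apply/measurable_EFinP; exact: measurable_indic.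
Qed.

End wasserstein_bounds.

(** * Averaging over the sphere *)

Section lebesgue_tuple_integral.
Context {R : realType}.

Lemma lebesgue_tuple_sigma_finite n :
  sigma_finite setT (@lebesgue_tuple R n).
Proof.
exists (fun k : nat => cube n k%:R); last first.
  move=> k; split; first exact: measurable_cube.
  by rewrite lebesgue_tuple_cube// ltry.
apply/seteqP; split => // x _.
exists (Num.bound (\sum_i `|tnth x i|)) => // i.
rewrite in_itv/= -ler_norml; apply: le_trans (ltW (archi_boundP _)).
  by rewrite (bigD1 i)//= lerDl sumr_ge0.
by apply: sumr_ge0.
Qed.

(** A copy of [lebesgue_tuple n] that carries a sigma-finite structure, as
    required by Tonelli's theorem. *)
Definition lebesgue_sf n : set (n.-tuple R) -> \bar R := lebesgue_tuple n.

HB.instance Definition _ n := isMeasure.Build _ _ _ (@lebesgue_sf n)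
  (measure0 (lebesgue_tuple n)) (measure_ge0 (lebesgue_tuple n))
  (@measure_semi_sigma_additive _ _ _ (lebesgue_tuple n)).

HB.instance Definition _ n := Measure_isSigmaFinite.Build _ _ _ (@lebesgue_sf n)
  (@lebesgue_tuple_sigma_finite n).

Lemma measurable_prod_tnth n (f : 'I_n -> R -> R) :
  (forall i, measurable_fun setT (f i)) ->
  measurable_fun setT (fun x : n.-tuple R => (\prod_i f i (tnth x i))%:E).
Proof.
move=> mf; apply/measurable_EFinP; apply: measurable_prod => i _.
exact: (measurableT_comp (mf i) (measurable_tnth i)).
Qed.

Lemma integral_lebesgue_tuple_prod n (f : 'I_n -> R -> R) (M : 'I_n -> R) :
  (forall i, measurable_fun setT (f i)) -> (forall i x, 0 <= f i x) ->
  (forall i, \int[@lebesgue_measure R]_x (f i x)%:E <= (M i)%:E)%E ->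
  (\int[@lebesgue_tuple R n]_x (\prod_i f i (tnth x i))%:E
     <= (\prod_i M i)%:E)%E.
Proof.
elim: n f M => [f M mf _ _|n IH f M mf f0 fM].
  rewrite integral_dirac//; last exact: (measurable_prod_tnth mf).
  by rewrite diracT mul1e !big_ord0.
have M0 i : 0 <= M i.
  rewrite -lee_fin (le_trans _ (fM i))//.
  by apply: integral_ge0 => x _; rewrite lee_fin.
have mF := measurable_prod_tnth mf.
rewrite [leLHS](ge0_integral_pushforward (@measurable_tcons R n)
  (@lebesgue_sf n \x @lebesgue_measure R)%E)//; last first.
  by move=> x _; rewrite lee_fin prodr_ge0.
pose g (i : 'I_n) := f (lift ord0 i).
have E (z : n.-tuple R * measurableTypeR R) :
    (\prod_i f i (tnth (tcons z) i) = \prod_i g i (tnth z.1 i) * f ord0 z.2)%R.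
  rewrite big_ord_recl mulrC; congr (_ * _).
  by apply: eq_bigr => i _; rewrite tnthS.
rewrite preimage_setT fubini_tonelli1; first last.
- by move=> z; rewrite lee_fin prodr_ge0.
- exact: (measurableT_comp mF (@measurable_tcons R n)).
rewrite big_ord_recl mulrC EFinM.
have mg : forall i, measurable_fun setT (g i) by move=> i; exact: mf.
have g0 : forall i x, 0 <= g i x by move=> i x; exact: f0.
apply: (@le_trans _ _ (\int[lebesgue_tuple n]_x
    ((\prod_i g i (tnth x i))%:E * (M ord0)%:E))%E); last first.
  have mG := measurable_prod_tnth mg.
  rewrite ge0_integralZr//; first last.
  - by rewrite lee_fin.
  - by move=> x _; rewrite lee_fin prodr_ge0.
  by apply: lee_wpmul2r; [rewrite lee_fin|apply: IH => // i; exact: fM].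
apply: ge0_le_integral_nonmeasurable => x _.
  by apply: integral_ge0 => y _; rewrite lee_fin prodr_ge0.
rewrite /fubini_F.
under eq_integral do rewrite /= E /= EFinM.
rewrite ge0_integralZl//; first last.
- by rewrite lee_fin prodr_ge0.
- by move=> y _; rewrite lee_fin.
- by apply/measurable_EFinP; exact: mf.
by apply: lee_wpmul2l => //; rewrite lee_fin prodr_ge0.
Qed.

End lebesgue_tuple_integral.

Section decay.
Context {R : realType}.
Implicit Types (eps x c t : R).

(** An integrable substitute for [min 1 (eps / |x|) ^+ 2], smooth and with the
    explicit antiderivative [2 * eps * atan (x / eps)]. *)
Definition decay eps x : R := 2 * eps ^+ 2 / (eps ^+ 2 + x ^+ 2).

Lemma decay_ge0 eps x : 0 <= decay eps x.
Proof.
by apply: divr_ge0; [apply: mulr_ge0 => //|apply: addr_ge0]; exact: sqr_ge0.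
Qed.

Lemma le_decay eps x y : 0 < eps -> `|x| <= `|y| -> decay eps y <= decay eps x.
Proof.
move=> e0 xy; have e2 : 0 < eps ^+ 2 by exact: exprn_gt0.
have pos z : 0 < eps ^+ 2 + z ^+ 2 by rewrite ltr_pwDl ?sqr_ge0.
rewrite /decay ler_wpM2l ?lef_pV2 ?posrE//; first by rewrite mulr_ge0 ?sqr_ge0.
rewrite lerD2l -(real_normK (num_real x)) -(real_normK (num_real y)).
by rewrite lerXn2r ?nnegrE.
Qed.

Lemma sqr_loss_le_decay eps c t x : 0 < eps -> 0 < c -> `|t| <= 1 ->
  loss (t * (c * eps)) (x * c) ^+ 2 <= decay eps x.
Proof.
move=> e0 c0 t1; have e2 : 0 < eps ^+ 2 by exact: exprn_gt0.
rewrite /decay ler_pdivlMr ?ltr_pwDl ?sqr_ge0//.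
rewrite /loss mulf_eq0 (gt_eqF c0) orbF; case: eqP => [->|/eqP x0].
  by rewrite expr1n expr0n/=; lra.
rewrite (_ : _ / _ = t * eps / x); last by field; rewrite x0 gt_eqF.
set m := Num.min 1 _.
have m0 : 0 <= m by rewrite le_min ler01 normr_ge0.
have m1 : m ^+ 2 <= 1 by rewrite expr_le1// ge_min lexx.
have mx : m ^+ 2 * x ^+ 2 <= eps ^+ 2.
  rewrite -(real_normK (num_real x)) -exprMn.
  rewrite lerXn2r ?nnegrE ?mulr_ge0 ?(ltW e0)//.
  rewrite -ler_pdivlMr ?normr_gt0// /m ge_min; apply/orP; right.
  rewrite normrM normfV ler_pM2r ?invr_gt0 ?normr_gt0//.
  by rewrite normrM (gtr0_norm e0) ler_piMl// ltW.
have := ler_wpM2r (ltW e2) m1; lra.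
Qed.

Lemma continuous_decay eps : 0 < eps -> continuous (decay eps).
Proof.
move=> e0 x; apply: cvgM; first exact: cvg_cst.
apply: cvgV; first by rewrite gt_eqF// ltr_pwDl ?sqr_ge0 ?exprn_gt0.
apply: cvgD; first exact: cvg_cst.
exact: exprn_continuous.
Qed.

Lemma integral_decay eps : 0 < eps ->
  (\int[@lebesgue_measure R]_(x in [set` `[-1, 1]%R]) (decay eps x)%:E
     <= (2 * pi * eps)%:E)%E.
Proof.
move=> e0.
pose F x : R := 2 * eps * atan (x / eps).
have dF x : is_derive x 1 F (decay eps x).
  have dm : is_derive x 1 (fun y : R => y / eps) eps^-1.
    have -> : (fun y : R => y / eps) = eps^-1 *: (@id R).
      by apply/funext => y; rewrite /= mulrC.
    by apply: is_derive_eq; rewrite -[RHS]mulr1.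
  have da := @is_derive1_comp R atan (fun y => y / eps) x _ _
    (is_derive1_atan (x / eps)) dm.
  have -> : F = (2 * eps) *: (@atan R \o (fun y => y / eps)) by [].
  apply: is_derive_eq; rewrite /decay /GRing.scale/=; field.
  by rewrite (gt_eqF e0) gt_eqF// ltr_pwDl ?sqr_ge0 ?exprn_gt0.
have cF : continuous F.
  move=> x; apply: differentiable_continuous.
  by apply/derivable1_diffP; exact: ex_derive.
rewrite (@continuous_FTC2 _ _ F).
- rewrite -EFinB lee_fin /F -mulrBr [leRHS]mulrAC ler_pM2l ?mulr_gt0//.
  have := atan_ltpi2 (1 / eps : R); have := atan_gtNpi2 (-1 / eps : R); lra.
- lra.
- by apply: continuous_subspaceT; exact: continuous_decay.
- split => [x _||]; first exact: ex_derive.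
    by apply: cvg_at_right_filter; exact: cF.
  by apply: cvg_at_left_filter; exact: cF.
- by move=> x _; rewrite derive1E; exact: derive_val.
Qed.

End decay.

Section sphere.
Context {R : realType} {n : nat}.
Implicit Types (eps : R) (x theta : n.+1.-tuple R).

Definition ball_volume : R := fine (lebesgue_tuple n.+1 (@unit_ball R n.+1)).

Lemma ball_volume_gt0 : 0 < ball_volume.
Proof.
apply: fine_gt0; rewrite lebesgue_unit_ball_gt0/=.
by have := @lebesgue_unit_ball_fin_num R n.+1; rewrite ge0_fin_numE.
Qed.

Lemma measurable_unit_sphere : measurable (@unit_sphere R n.+1).
Proof.
have := measurable_preimage (@measurable_enorm R n.+1) (measurable_set1 1).
exact.
Qed.

Lemma unit_ball_normr_le1 x i : unit_ball x -> `|tnth x i| <= 1.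
Proof. by move=> /unit_ball_cube/(_ i); rewrite in_itv/= -ler_norml. Qed.

Lemma normalize_ge x i : unit_ball x -> `|tnth x i| <= `|tnth (normalize x) i|.
Proof.
move=> x1; rewrite tnth_mktuple normrM normfV.
have e0 : 0 <= enorm x by exact: sqrtr_ge0.
have xe := tnth_enorm x i.
have [xi0|xi0] := eqVneq (tnth x i) 0; first by rewrite xi0 normr0 mul0r.
have ep : 0 < enorm x by apply: lt_le_trans xe; rewrite normr_gt0.
by rewrite (gtr0_norm ep) ler_pdivlMr// ler_piMr.
Qed.

Definition sphere_decay eps theta : R :=
  \prod_(i < n) decay eps (tnth theta (lift ord0 i)).

Lemma measurable_sphere_decay eps : 0 < eps ->
  measurable_fun setT (sphere_decay eps).
Proof.
move=> e0; apply: measurable_prod => i _.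
apply: (measurableT_comp _ (measurable_tnth (lift ord0 i))).
by apply: continuous_measurable_fun; exact: continuous_decay.
Qed.

Lemma sphere_decay_ge0 eps theta : 0 <= sphere_decay eps theta.
Proof. by apply: prodr_ge0 => i _; exact: decay_ge0. Qed.

(** The ball lies in the cube, where Tonelli's theorem applies: the coordinate 0
    contributes the length 2 and each of the others [2 * pi * eps]. *)
Lemma integral_ball_decay eps : 0 < eps ->
  (\int[@lebesgue_tuple R n.+1]_(x in unit_ball) (sphere_decay eps x)%:E
     <= (2 * (2 * pi * eps) ^+ n)%:E)%E.
Proof.
move=> e0; pose U : set (measurableTypeR R) := [set` `[-1, 1]%R].
have mU : measurable U by exact: measurable_itv.
have md : measurable_fun setT (decay eps).
  by apply: continuous_measurable_fun; exact: continuous_decay.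
pose f (i : 'I_n.+1) (r : R) :=
  (\1_U r * (if i == ord0 then 1 else decay eps r))%R.
pose M (i : 'I_n.+1) : R := if i == ord0 then 2 else 2 * pi * eps.
have mf i : measurable_fun setT (f i).
  apply: measurable_funM; first exact: measurable_indic.
  by case: (i == ord0); [exact: measurable_cst|exact: md].
have f0 i r : 0 <= f i r.
  by rewrite mulr_ge0//; case: ifP => // _; exact: decay_ge0.
have fM i : (\int[@lebesgue_measure R]_r (f i r)%:E <= (M i)%:E)%E.
  rewrite (_ : (fun r => _) =
    (EFin \o (fun r => if i == ord0 then 1 else decay eps r)) \_ U); last first.
    apply/funext => r; rewrite /f /= patchE indicE.
    by case: (r \in U); rewrite ?mul1r ?mul0r.
  rewrite -integral_mkcond /M; case: (i == ord0); last exact: integral_decay.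
  have lU : lebesgue_measure U = 2%:E.
    by rewrite lebesgue_measure_itv/= lte_fin ltrN11 -EFinD opprK.
  by rewrite integral_cst// mul1e [leLHS]lU.
have := integral_lebesgue_tuple_prod mf f0 fM.
rewrite [in X in (_ <= X)%E]big_ord_recl [M ord0]/M eqxx.
rewrite [X in (2 * X)%R](_ : _ = (2 * pi * eps) ^+ n); last first.
  by rewrite (eq_bigr (fun=> 2 * pi * eps))// prodr_const card_ord.
apply: le_trans.
have mF := measurable_prod_tnth mf.
apply: (@le_trans _ _ (\int[lebesgue_tuple n.+1]_(x in unit_ball)
    (\prod_i f i (tnth x i))%:E)%E); last first.
  apply: ge0_subset_integral => //; first exact: measurable_unit_ball.
  by move=> x _; rewrite lee_fin prodr_ge0.
apply: ge0_le_integral_nonmeasurable => x x1; rewrite lee_fin ?sphere_decay_ge0//.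
have U1 i : \1_U (tnth x i) = 1 :> R.
  by rewrite indicE mem_set// /U /= in_itv/= -ler_norml unit_ball_normr_le1.
rewrite big_ord_recl /f U1 eqxx !mul1r /sphere_decay.
by apply: ler_prod => i _; rewrite decay_ge0 U1 mul1r/=.
Qed.

(** The law on the sphere is that of [x / |x|] for [x] uniform in the ball, where
    the normalization only increases the coordinates and so decreases [decay]. *)
Lemma integral_sphere_decay eps : 0 < eps ->
  (\int[@uniform_sphere R n.+1]_(theta in unit_sphere) (sphere_decay eps theta)%:E
     <= (ball_volume^-1 * (2 * (2 * pi * eps) ^+ n))%:E)%E.
Proof.
move=> e0.
have mB := @measurable_unit_ball R n.+1.
have mS := measurable_unit_sphere.
have mD : measurable_fun setT (fun theta => (sphere_decay eps theta)%:E).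
  by apply/measurable_EFinP; exact: measurable_sphere_decay.
have mN := @measurable_normalize R n.+1.
rewrite [leLHS](ge0_integral_pushforward mN (uniform_ball n.+1))//; last 2 first.
- exact: measurable_funTS.
- by move=> x _; rewrite lee_fin sphere_decay_ge0.
have mDN := measurableT_comp mD mN.
apply: (@le_trans _ _
    (\int[uniform_ball n.+1]_x (sphere_decay eps (normalize x))%:E)%E).
  apply: ge0_subset_integral => //.
  - exact: measurable_preimage mN mS.
  - by move=> x _; rewrite lee_fin sphere_decay_ge0.
rewrite (@ge0_negligible_integral _ _ _ _ setT (~` unit_ball))//; last 3 first.
- exact: measurableC.
- by move=> x _; rewrite lee_fin sphere_decay_ge0.
- by rewrite [LHS]uniform_ballE setICl measure0 mul0e.
rewrite setTD setCK.
have k0 : 0 <= ball_volume^-1 by rewrite invr_ge0 ltW// ball_volume_gt0.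
rewrite (eq_measure_integral (mscale (NngNum k0) (lebesgue_tuple n.+1))); last first.
  move=> A mA AB; rewrite [LHS]uniform_ballE /mscale/= muleC.
  by congr (_ * lebesgue_step _ _)%E; apply/setIidl.
rewrite ge0_integral_mscale//; last 2 first.
- exact: measurable_funTS.
- by move=> x _; rewrite lee_fin sphere_decay_ge0.
rewrite EFinM; apply: lee_wpmul2l; first by rewrite lee_fin.
apply: le_trans (integral_ball_decay e0).
apply: ge0_le_integral_nonmeasurable => x x1; rewrite lee_fin ?sphere_decay_ge0//.
apply: ler_prod => i _; rewrite decay_ge0/=.
by apply: le_decay => //; exact: normalize_ge.
Qed.

End sphere.

(** * The sliced distance *)

Section sliced_bound.
Context {R : realType} {n : nat}.

Definition twice_each : seq 'I_n.+1 :=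
  let s := [seq lift ord0 i | i <- enum 'I_n] in s ++ s.

Lemma size_twice_each : size twice_each = (2 * n)%N.
Proof. by rewrite size_cat size_map size_enum_ord addnn mul2n. Qed.

Lemma ord0_notin_twice_each : ord0 \notin twice_each.
Proof.
rewrite mem_cat orbb; apply/mapP => -[i _ /eqP].
by rewrite eq_liftF.
Qed.

Lemma prod_twice_each (F : 'I_n.+1 -> R) :
  \prod_(i <- twice_each) F i = \prod_(i < n) F (lift ord0 i) ^+ 2.
Proof. by rewrite big_cat big_map big_enum/= -expr2 prodrXl. Qed.

(** On the sphere [|theta_0| <= 1], and the two occurrences of each coordinate in
    [twice_each] turn [loss] into its square, hence into [decay]. *)
Lemma SW1_parity_law eps c : 0 < eps -> 0 < c ->
  forall disp (T : measurableType disp) (P : probability T R) X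
    (sX : parity_pair (c * eps) c twice_each P X),
  (SW1 (parity_law sX false) (parity_law sX true) <=
    (c * eps * (@ball_volume R n)^-1 * (2 * (2 * pi * eps) ^+ n))%:E)%E.
Proof.
move=> e0 c0 disp T P X sX.
have ce0 : 0 <= c * eps by rewrite mulr_ge0 ?ltW.
have mS := @measurable_unit_sphere R n.
apply: (@le_trans _ _ (\int[@uniform_sphere R n.+1]_(theta in unit_sphere)
    ((c * eps)%:E * (sphere_decay eps theta)%:E))%E).
  apply: ge0_le_integral_nonmeasurable => theta th1.
    by apply/ereal_infP => _ [g _ <-]; apply: integral_ge0.
  apply: (le_trans (W1_line_parity_law sX theta)).
  have t1 : `|tnth theta ord0| <= 1.
    by apply: unit_ball_normr_le1; rewrite /unit_ball/= th1.
  rewrite -EFinM lee_fin prod_twice_each; apply: ler_pM => //.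
  - by apply: prodr_ge0 => i _; exact: sqr_ge0.
  - by rewrite normrM (ger0_norm ce0) ler_piMl.
  - apply: ler_prod => i _; rewrite sqr_ge0/=.
    exact: sqr_loss_le_decay.
rewrite ge0_integralZl//.
- rewrite -mulrA [leRHS]EFinM; apply: lee_wpmul2l; first by rewrite lee_fin.
  exact: integral_sphere_decay.
- apply: measurable_funTS; apply/measurable_EFinP; exact: measurable_sphere_decay.
- by move=> theta _; rewrite lee_fin sphere_decay_ge0.
Qed.

End sliced_bound.

Theorem mainTheorem2 (R : realType) (d : nat) (hd : (2 <= d)%N) :
  exists C : R, 0 < C /\
    forall eps : R, 0 < eps -> eps < 1 ->
      exists p q : probability (d.-tuple R) R,
        [/\ p unit_ball = 1%E, q unit_ball = 1%E,
            ((eps / C)%:E <= W1 p q)%E &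
            (SW1 p q <= (C * eps ^+ d)%:E)%E].
Proof.
case: d hd => // n _.
(* c = 1 / a: with 2 n steps, the l1 norm of a point is at most
   c (2 n + 1) + c (2 n), which is below 4 (n + 1) c = 1. *)
pose a : R := 4 * n.+1%:R.
have a0 : 0 < a by rewrite mulr_gt0.
(* b eps ^+ n.+1 is the bound of SW1_parity_law for this c. *)
pose b : R := a^-1 * (@ball_volume R n)^-1 * (2 * (2 * pi) ^+ n).
have b0 : 0 <= b.
  have pi0 := pi_ge0 R.
  rewrite mulr_ge0 ?mulr_ge0 ?invr_ge0 ?(ltW a0) ?(ltW (@ball_volume_gt0 R n))//.
  by rewrite exprn_ge0// mulr_ge0.
exists (a + b); split; first exact: ltr_pwDl.
move=> eps e0 e1.
have c0 : 0 < a^-1 by rewrite invr_gt0.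
have h0 : 0 <= a^-1 * eps by rewrite mulr_ge0 ?ltW.
have [disp [T [P [X sX]]]] :=
  exists_parity_pair h0 (ltW c0) (@ord0_notin_twice_each n).
exists (parity_law sX false), (parity_law sX true).
have fits : a^-1 * eps * (size (@twice_each n)).+1%:R
    + a^-1 * (size (@twice_each n))%:R <= 1.
  rewrite size_twice_each -mulrA -mulrDr mulrC ler_pdivrMr// mul1r /a.
  rewrite -!natr1 natrM.
  have : 0 <= n%:R :> R by [].
  nra.
split.
- exact: parity_law_unit_ball.
- exact: parity_law_unit_ball.
- apply: le_trans (W1_parity_law h0 sX).
  rewrite lee_fin mulrC ler_pM2r// lef_pV2 ?posrE// ?lerDl// ltr_pwDl//.
- apply: (le_trans (SW1_parity_law e0 c0 sX)).
  rewrite lee_fin exprS [leRHS]mulrDl -[leLHS]add0r.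
  apply: lerD.
    by rewrite mulr_ge0 ?(ltW a0)// mulr_ge0 ?exprn_ge0 ?(ltW e0).
  by rewrite /b exprMn le_eqVlt; apply/orP; left; apply/eqP; ring.
Qed.
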